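(* Let $n,d\ge1$. For $k\in\mathbb N$ let $(\mu^k,\Psi^k)$ be entropy pairs of the systems $$\partial_t\mu^{i}_t=\nabla\cdot\big(\mu^{i}_t\,\mathfrak K^{k,i}[\mu]_t\big)+D^{k,i}\Delta\mu^{i}_t,\qquad i=1,\dots,n,$$ where $D^{k,i}\ge0$ and each operator $\mathfrak K^k$ satisfies: for all $t>0$, $\mathfrak K^{k,i}: C([0,t];\mathcal P_1(\mathbb R^d)^n)\to C([0,t];\mathrm{Lip}_0(\mathbb R^d;\mathbb R^d))$ depends only on the past, maps bounded sets into bounded sets, and, for each $T>0$, there is $L_k$ with $\sup_{t\in[0,T],i}\big\|\frac{\mathfrak K^{k,i}[\mu]_t-\mathfrak K^{k,i}[\widehat\mu]_t}{1+|x|}\big\|_{L^\infty}\le L_k\sup_{t\in[0,T],i}d_1(\mu^i_t,\widehat\mu^i_t)$. Let $D^\infty=(D^{\infty,i})_i$, an operator $\mathfrak K^\infty$, a curve $t\mapsto\mu^\infty_t\in\mathcal P_1(\mathbb R^d)^n$ and a family of linear maps $\Psi^\infty=\{\Psi^{T,\infty}\}_{T\ge0}$ be given, and assume that: 1. $D^{k}\to D^{\infty}$; 2. for every $t>0$, $\mu^k_t\rightharpoonup\mu^\infty_t$ weakly-$\star$ in $\mathcal M(\mathbb R^d)$ (componentwise); 3. for every $\psi_0\in C_c^\infty(\mathbb R^d)$ and $T>0$, $\Psi^{T,k}[\psi_0]\to\Psi^{T,\infty}[\psi_0]$ uniformly over compacts of $[0,T]\times\mathbb R^d$; 4. $\mathfrak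 K^k[\mu^k]\to\mathfrak K^\infty[\mu^\infty]$ uniformly over compacts of $[0,T]\times\mathbb R^d$ (for every $T>0$); 5. for every $\psi_0\in C_c^\infty(\mathbb R^d)$ (and $T>0$), componentwise, $\int_{\mathbb R^d}\Psi^{T,k}[\psi_0]_T\,d\mu^k_0\to\int_{\mathbb R^d}\Psi^{T,\infty}[\psi_0]_T\,d\mu^\infty_0$. Then $(\mu^\infty,\Psi^\infty)$ is an entropy pair of the limit problem $\partial_t\mu^{i}_t=\nabla\cdot(\mu^{i}_t\,\mathfrak K^{\infty,i}[\mu]_t)+D^{\infty,i}\Delta\mu^{i}_t$, $i=1,\dots,n$.
   Context: Spaces. $\mathcal P_1(\mathbb R^d)$ is the set of Borel probability measures on $\mathbb R^d$ with finite first moment, with the 1-Wasserstein distance $d_1$; bounded sets of curves are those with uniformly bounded first moments. $\mathcal M(\mathbb R^d)$ is the space of finite Radon measures. $\mathrm{Lip}_0(\mathbb R^d;\mathbb R^d)$ is the space of continuous fields $E$ with $|\nabla E|\in L^\infty$, with norm $\|\nabla E\|_{L^\infty}+\|E/(1+|x|)\|_{L^\infty}$. Dependence on the past. $\mathfrak K$ depends only on the past if for $0\le t\le s$ one has $(\mathfrak K^i[\mu|_{[0,s]}])_t=(\mathfrak K^i[\mu|_{[0,t]}])_t$; one writes $\mathfrak K^i[\mu]_t$. Viscosity solutions. For a continuous field $b:[0,T]\times\mathbb R^d\to\mathbb R^d$ and $D\ge0$, $\psi\in C([0,T]\times\mathbb R^d)$ is a viscosity sub-solution of $\partial_s\psi_s=b_s\cdot\nabla\psi_s+D\Delta\psi_s$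 if for every $z_0=(s_0,x_0)\in(0,T]\times\mathbb R^d$, every neighbourhood $U$ of $z_0$ (in $[0,T]\times\mathbb R^d$) and every $\varphi\in C^2(U)$ with $\varphi\ge\psi$ on $U$, $\varphi(z_0)=\psi(z_0)$, one has $\partial_s\varphi(z_0)\le b_{s_0}(x_0)\cdot\nabla\varphi(z_0)+D\Delta\varphi(z_0)$. Super-solution: reversed inequality for $\varphi$ touching from below. Viscosity solution: both. Entropy pair (for operator $\mathfrak K$ and diffusions $D^i$). $(\mu,\{\Psi^T\}_{T\ge0})$ is an entropy pair if for every $T\ge0$: (1) $\Psi^T$ is a linear map from $\{\psi_0:\nabla\psi_0\in L^\infty(\mathbb R^d)\}$ to $\{(\psi^1,\dots,\psi^n)\in C([0,T]\times\mathbb R^d)^n:\ \psi^i/(1+|x|)\in L^\infty((0,T)\times\mathbb R^d)\}$ such that for every $\psi_0$ and $i$, $\psi^{T,i}=\Psi^{T,i}[\psi_0]$ is a viscosity solution of $\partial_s\psi^{T,i}_s=-\mathfrak K^i[\mu|_{[0,T-s]}]_{T-s}\cdot\nabla\psi^{T,i}_s+D^i\Delta\psi^{T,i}_s$, $s\in[0,T]$, $\psi^{T,i}_0=\psi_0$; (2) for each $i$, $\mu^i_T\in\mathcal P_1(\mathbb R^d)$ and $\int\psi_0\,d\mu^i_T=\int\psi^{T,i}_T\,d\mu^i_0$ for all such $\psi_0$. The maps $\Psi^{T,\infty}$ in the claim have the same domain and target spaces as in (1).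
   Formalization: Added: each Lipschitz ψ0 is a locally uniform limit, with a common linear growth bound, of some test functions along which Ψ^{T,∞} converges likewise (else Ψ^{T,∞} is unconstrained off C_c^∞ and the claim fails); assumption 3 is also taken at T=0. *)

(* Defs.v *)
From HB Require Import structures.
From mathcomp Require Export all_boot all_order all_algebra.
From mathcomp Require Export all_classical all_reals all_analysis.
Export Order.TTheory GRing.Theory Num.Theory.
Export numFieldNormedType.Exports.

Set Implicit Arguments.
Unset Strict Implicit.
Unset Printing Implicit Defensive.

Local Open Scope classical_set_scope.
Local Open Scope ring_scope.

Section Space.
Context {R : realType} {d : nat}.
Notation Rd := 'rV[R]_d.

(* The library norm of 'rV[R]_d is the sup norm: it has the right topology, but
   the estimates below are written with the Euclidean norm. *)
Definition enorm (x : Rd) : R := Num.sqrt (\sum_(i < d) x ord0 i ^+ 2).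

Definition dotp (x y : Rd) : R := \sum_(i < d) x ord0 i * y ord0 i.

(* "grad psi0 is in L^oo(R^d)": psi0 is (globally) Lipschitz. *)
Definition bounded_gradient (psi0 : Rd -> R) : Prop :=
  exists L : R, forall x y, `|psi0 x - psi0 y| <= L * enorm (x - y).

(* C^k on a set W, which is open in all uses: the iterated directional
   derivatives up to order k exist and are continuous at every point of W. *)
Fixpoint Ck_on {V : normedModType R} (k : nat) (W : set V) (f : V -> R) : Prop :=
  (forall z, W z -> {for z, continuous f}) /\
  match k with
  | 0%N => True
  | k'.+1 => forall v : V, (forall z, W z -> derivable f z v) /\
                           Ck_on k' W (fun z => 'D_v f z)
  end.

(* C_c^oo(R^d) *)
Definition test_function (psi0 : Rd -> R) : Prop :=
  (forall k, Ck_on k setT psi0) /\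
  exists r : R, forall x, r < enorm x -> psi0 x = 0.

(* C_0(R^d), whose dual is the space of finite Radon measures *)
Definition vanishing_continuous (f : Rd -> R) : Prop :=
  continuous f /\
  forall eps : R, 0 < eps -> exists r : R, forall x, r < enorm x -> `|f x| <= eps.

(* ||grad E||_{L^oo} for a continuous field E, with the operator norm on
   matrices, is the optimal Lipschitz constant. *)
Definition gradient_norm (E : Rd -> Rd) : \bar R :=
  ereal_sup [set ((enorm (E z.1 - E z.2) / enorm (z.1 - z.2))%:E : \bar R)
            | z in [set z : Rd * Rd | z.1 != z.2]].

Definition weighted_norm (E : Rd -> Rd) : \bar R :=
  ereal_sup [set ((enorm (E x) / (1 + enorm x))%:E : \bar R) | x in [set: Rd]].

Definition Lip0_norm (E : Rd -> Rd) : \bar R :=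
  (gradient_norm E + weighted_norm E)%E.

Definition Lip0 (E : Rd -> Rd) : Prop :=
  continuous E /\ (gradient_norm E < +oo)%E.

End Space.

(* R^d with its Borel sigma-algebra *)
Definition borelRd (R : realType) (d : nat) :=
  g_sigma_algebraType (@open 'rV[R]_d).

Section Measures.
Context {R : realType} {d : nat}.
Notation prob := (probability (borelRd R d) R).

Definition first_moment (mu : prob) : \bar R :=
  (\int[mu]_x (enorm (x : 'rV[R]_d))%:E)%E.

Definition in_P1 (mu : prob) : Prop := (first_moment mu < +oo)%E.

Definition coupling (mu nu : prob)
    (pi : probability (borelRd R d * borelRd R d)%type R) : Prop :=
  forall A : set (borelRd R d), measurable A ->
    pi (A `*` setT) = mu A /\ pi (setT `*` A) = nu A.

(* 1-Wasserstein distance *)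
Definition d1 (mu nu : prob) : \bar R :=
  ereal_inf [set (\int[pi]_z (enorm ((z.1 : 'rV[R]_d) - (z.2 : 'rV[R]_d)))%:E)%E
            | pi in coupling mu nu].

End Measures.

Definition curve (R : realType) (n d : nat) :=
  R -> 'I_n -> probability (borelRd R d) R.

(* K t mu s i x is (K^i[mu|_[0,t]])_s (x). Functions on [0,t] are represented by
   functions on R, see [restr]. *)
Definition operator (R : realType) (n d : nat) :=
  R -> curve R n d -> R -> 'I_n -> 'rV[R]_d -> 'rV[R]_d.

(* Psi T psi0 i (s, x) is Psi^{T,i}[psi0](s, x), relevant for s in [0,T] only. *)
Definition solution_maps (R : realType) (n d : nat) :=
  R -> ('rV[R]_d -> R) -> 'I_n -> R * 'rV[R]_d -> R.

Section Operators.
Context {R : realType} {n d : nat}.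
Implicit Types (mu nu : curve R n d) (K : operator R n d).

(* mu|_[0,t], as a function on R that is constant before 0 and after t *)
Definition restr (t : R) mu : curve R n d :=
  fun s => mu (Num.max 0 (Num.min s t)).

(* K[mu]_t := (K[mu|_[0,t]])_t *)
Definition at_time K mu (t : R) : 'I_n -> 'rV[R]_d -> 'rV[R]_d :=
  K t (restr t mu) t.

(* mu|_[0,t] is in C([0,t]; P_1(R^d)^n) *)
Definition curve_C (t : R) mu : Prop :=
  (forall (s : R) i, 0 <= s <= t -> in_P1 (mu s i)) /\
  (forall (s : R) i, 0 <= s <= t -> forall eps : R, 0 < eps ->
     exists2 delta : R, 0 < delta &
       forall r : R, 0 <= r <= t -> `|r - s| < delta ->
         (d1 (mu r i) (mu s i) < eps%:E)%E).

(* E is in C([0,t]; Lip_0(R^d; R^d)^n) *)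
Definition field_C (t : R) (E : R -> 'I_n -> 'rV[R]_d -> 'rV[R]_d) : Prop :=
  (forall (s : R) i, 0 <= s <= t -> Lip0 (E s i)) /\
  (forall (s : R) i, 0 <= s <= t -> forall eps : R, 0 < eps ->
     exists2 delta : R, 0 < delta &
       forall r : R, 0 <= r <= t -> `|r - s| < delta ->
         (Lip0_norm (fun x => (E r i x - E s i x)%R) < eps%:E)%E).

Definition well_defined K : Prop :=
  forall t mu, 0 < t -> curve_C t mu -> field_C t (K t (restr t mu)).

(* The value K 0 (restr 0 mu) 0, i.e. K[mu]_0, is fixed by the case t = 0. *)
Definition depends_on_past K : Prop :=
  forall s t mu, 0 < s -> 0 <= t <= s -> curve_C s mu ->
    K s (restr s mu) t = K t (restr t mu) t.

Definition bounded_to_bounded K : Prop :=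
  forall t : R, 0 < t -> forall M : R, exists M' : R, forall mu,
    curve_C t mu ->
    (forall (s : R) i, 0 <= s <= t -> (first_moment (mu s i) <= M%:E)%E) ->
    forall (s : R) i, 0 <= s <= t -> (Lip0_norm (K t (restr t mu) s i) <= M'%:E)%E.

Definition sup_time (T : R) (f : R -> 'I_n -> \bar R) : \bar R :=
  ereal_sup [set f p.1 p.2 | p in [set p : R * 'I_n | 0 <= p.1 <= T]].

Definition lipschitz_operator K : Prop :=
  forall T : R, 0 < T -> exists2 L : R, 0 <= L & forall mu nu,
    curve_C T mu -> curve_C T nu ->
    (sup_time T (fun t i =>
       weighted_norm (fun x => (at_time K mu t i x - at_time K nu t i x)%R))
     <= L%:E * sup_time T (fun t i => d1 (mu t i) (nu t i)))%E.

Definition admissible_operator K : Prop :=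
  [/\ well_defined K, depends_on_past K, bounded_to_bounded K
    & lipschitz_operator K].

End Operators.

Section Viscosity.
Context {R : realType} {d : nat}.
Notation Rd := 'rV[R]_d.

(* [0,T] x R^d *)
Definition slab (T : R) : set (R * Rd) := [set z | 0 <= z.1 <= T].

Definition dt (phi : R * Rd -> R) (z : R * Rd) : R := 'D_((1, 0) : R * Rd) phi z.

Definition dx (i : 'I_d) (phi : R * Rd -> R) (z : R * Rd) : R :=
  'D_((0, delta_mx ord0 i) : R * Rd) phi z.

Definition grad (phi : R * Rd -> R) (z : R * Rd) : Rd := \row_i dx i phi z.

Definition laplacian (phi : R * Rd -> R) (z : R * Rd) : R :=
  \sum_(i < d) dx i (dx i phi) z.

(* A neighbourhood of z0 in [0,T] x R^d is the trace of a neighbourhood W in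
   R x R^d, and C^2 functions on it, up to the boundary s = T, are the
   restrictions of C^2 functions on W. *)
Definition visc_subsolution (T : R) (b : R -> Rd -> Rd) (D : R)
    (psi : R * Rd -> R) : Prop :=
  forall (z0 : R * Rd) (W : set (R * Rd)) (phi : R * Rd -> R),
    0 < z0.1 <= T -> open W -> W z0 -> Ck_on 2 W phi ->
    (forall z, W z -> slab T z -> psi z <= phi z) -> phi z0 = psi z0 ->
    dt phi z0 <= dotp (b z0.1 z0.2) (grad phi z0) + D * laplacian phi z0.

Definition visc_supersolution (T : R) (b : R -> Rd -> Rd) (D : R)
    (psi : R * Rd -> R) : Prop :=
  forall (z0 : R * Rd) (W : set (R * Rd)) (phi : R * Rd -> R),
    0 < z0.1 <= T -> open W -> W z0 -> Ck_on 2 W phi ->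
    (forall z, W z -> slab T z -> phi z <= psi z) -> phi z0 = psi z0 ->
    dotp (b z0.1 z0.2) (grad phi z0) + D * laplacian phi z0 <= dt phi z0.

(* The field is required to be continuous on [0,T] x R^d. *)
Definition visc_solution (T : R) (b : R -> Rd -> Rd) (D : R)
    (psi : R * Rd -> R) : Prop :=
  [/\ {within slab T, continuous (fun z : R * Rd => b z.1 z.2)},
      {within slab T, continuous psi},
      visc_subsolution T b D psi
    & visc_supersolution T b D psi].

End Viscosity.

Section EntropyPairs.
Context {R : realType} {n d : nat}.
Notation Rd := 'rV[R]_d.

(* PsiT is a linear map from {psi0 : grad psi0 in L^oo} to
   {psi in C([0,T] x R^d)^n : psi^i / (1 + |x|) in L^oo}. *)
Definition linear_solution_map (T : R)
    (PsiT : (Rd -> R) -> 'I_n -> R * Rd -> R) : Prop :=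
  (forall (a : R) (f g : Rd -> R), bounded_gradient f -> bounded_gradient g ->
     forall i z, slab T z ->
       PsiT (fun x => a * f x + g x) i z = a * PsiT f i z + PsiT g i z) /\
  (forall f : Rd -> R, bounded_gradient f -> forall i,
     {within slab T, continuous (PsiT f i)} /\
     exists A : R, forall z, slab T z -> `|PsiT f i z| <= A * (1 + enorm z.2)).

Definition entropy_pair (D : 'I_n -> R) (K : operator R n d)
    (mu : curve R n d) (Psi : solution_maps R n d) : Prop :=
  forall T : R, 0 <= T ->
  [/\ linear_solution_map T (Psi T),
      forall psi0 : Rd -> R, bounded_gradient psi0 -> forall i,
        visc_solution T (fun s x => - at_time K mu (T - s) i x) (D i)
          (Psi T psi0 i) /\
        (forall x, Psi T psi0 i (0, x) = psi0 x)
    & forall i, in_P1 (mu T i) /\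
        forall psi0 : Rd -> R, bounded_gradient psi0 ->
          \int[mu T i]_x psi0 x = \int[mu 0 i]_x Psi T psi0 i (T, x) ].

Definition cvg_on_compacts {X : topologicalType} {Y : uniformType} (S : set X)
    (f : nat -> X -> Y) (g : X -> Y) : Prop :=
  forall C : set X, compact C -> C `<=` S -> {uniform C, f @ \oo --> g}.

Definition weak_star_cvg (mu : nat -> probability (borelRd R d) R)
    (nu : probability (borelRd R d) R) : Prop :=
  forall f : Rd -> R, vanishing_continuous f ->
    \int[mu k]_x f x @[k --> \oo] --> \int[nu]_x f x.

(* Every admissible datum psi0 is a limit of test functions along which PsiT
   converges, both limits being uniform on compacts with a bound C (1 + |x|).
   C_c^oo is not dense in {psi0 : grad psi0 in L^oo} for its natural norm, hence
   a linear (even bounded) map on the latter is not determined by its values on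
   test functions. Without this property, PsiT could be changed by adding
   ell(psi0) * 1, with ell a linear functional that vanishes on C_c^oo; this
   affects no quantity that involves test functions only, but PsiT psi0 would no
   longer have initial value psi0. *)
Definition determined_by_test_functions (T : R)
    (PsiT : (Rd -> R) -> 'I_n -> R * Rd -> R) : Prop :=
  forall psi0 : Rd -> R, bounded_gradient psi0 ->
  exists phi : nat -> Rd -> R,
  [/\ forall m, test_function (phi m),
      cvg_on_compacts setT phi psi0,
      exists C : R, forall m x, `|phi m x| <= C * (1 + enorm x),
      forall i, cvg_on_compacts (slab T) (fun m => PsiT (phi m) i) (PsiT psi0 i)
    & forall i, exists C : R, forall m z, slab T z ->
        `|PsiT (phi m) i z| <= C * (1 + enorm z.2)].

End EntropyPairs.

(* Main.v *)
From HB Require Import structures.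
Require Import Defs.
From mathcomp Require Import ring lra.
From mathcomp Require Import measurable_realfun.

Set Implicit Arguments.
Unset Strict Implicit.
Unset Printing Implicit Defensive.
Local Open Scope classical_set_scope.
Local Open Scope ring_scope.

(** Viscosity sub-solutions are stable under locally uniform convergence of the
    solutions, the fields and the diffusions: if [phi] touches the limit from
    above at [z0], then [phi + q^2], with [q] the squared distance to [z0], has
    the same derivatives up to order two at [z0] and touches strictly, so that
    its translates touch the approximating solutions at points that tend to
    [z0].  Super-solutions follow by changing signs.  For a test function as
    initial datum, the equation and the duality identity thus pass to the limit
    in [k].  A general Lipschitz datum is a limit of test functions along which
    the solution maps converge locally uniformly with linear growth, so that
    stability applies a second time and dominated convergence, against measures
    with finite first moments, gives the duality identity. *)

(** * Uniform convergence on compacts *)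

Lemma uniform_cvgP {X : choiceType} {R : realFieldType} {V : normedModType R}
    (C : set X) (f : nat -> X -> V) (g : X -> V) :
  {uniform C, f @ \oo --> g} <->
  forall e : R, 0 < e -> \forall k \near \oo, forall x, C x -> `|g x - f k x| < e.
Proof.
split=> [fg e e0|fg P /uniform_nbhs[E [/= entE EP]]].
  apply: (fg [set h | forall x, C x -> `|g x - h x| < e]).
  apply/uniform_nbhs; exists [set xy | `|xy.1 - xy.2| < e].
  split; last by move=> h /= hE x Cx; exact: hE.
  rewrite -entourage_ballE; exists e => //= -[x y] /=.
  by rewrite -ball_normE.
move: entE; rewrite -entourage_ballE => -[e /= e0 eE].
apply: filterS (fg _ e0) => k fk; apply: EP => x Cx; apply: eE => /=.
by rewrite -ball_normE; exact: fk.
Qed.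

Lemma cvg_on_compactsP {X : topologicalType} {R : realFieldType}
    {V : normedModType R} (S : set X) (f : nat -> X -> V) (g : X -> V) :
  cvg_on_compacts S f g <->
  forall C, compact C -> C `<=` S -> forall e : R, 0 < e ->
    \forall k \near \oo, forall x, C x -> `|g x - f k x| < e.
Proof.
by split=> fg C cC CS; apply/uniform_cvgP; exact: fg.
Qed.

Lemma cvg_on_compacts_pointwise {X : topologicalType} {R : realFieldType}
    {V : normedModType R} (S : set X) (f : nat -> X -> V) (g : X -> V) x :
  cvg_on_compacts S f g -> S x -> f k x @[k --> \oo] --> g x.
Proof.
move=> /cvg_on_compactsP fg Sx; apply/cvgrPdist_lt => e e0.
have xS : [set x] `<=` S by move=> _ ->.
by have := fg _ (@compact_set1 _ x) xS _ e0; apply: filterS => k; apply.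
Qed.

(** A continuous image of a compact is compact. This serves for the time reversal in the equation of
    an entropy pair. *)
Lemma cvg_on_compacts_comp {X Y : topologicalType} {R : realFieldType}
    {V : normedModType R} (S : set X) (S' : set Y) (h : X -> Y)
    (f : nat -> Y -> V) (g : Y -> V) :
  continuous h -> h @` S `<=` S' -> cvg_on_compacts S' f g ->
  cvg_on_compacts S (fun k x => f k (h x)) (fun x => g (h x)).
Proof.
move=> hc hS /cvg_on_compactsP fg; apply/cvg_on_compactsP => C cC CS e e0.
have chC : compact (h @` C).
  by apply: continuous_compact => //; exact: continuous_subspaceT.
have hCS : h @` C `<=` S' by apply: subset_trans hS; exact: image_subset.
by apply: filterS (fg _ chC hCS _ e0) => k fk x Cx; apply: fk; exists x.
Qed.

(** * Euclidean norm and compact pieces of the slab *)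

Section Space.
Context {R : realType} {d : nat}.
Implicit Types (x y : 'rV[R]_d) (z : R * 'rV[R]_d).

Lemma coord_le_enorm x i : `|x ord0 i| <= enorm x.
Proof.
rewrite -sqrtr_sqr ler_sqrt ?sumr_ge0// => [|j _]; last exact: sqr_ge0.
by rewrite (bigD1 i)//= lerDl sumr_ge0// => j _; exact: sqr_ge0.
Qed.

Lemma norm_le_enorm x : `|x| <= enorm x.
Proof.
rewrite [leLHS]/Num.norm/= mx_normrE; apply/bigmax_leP.
split; first exact: sqrtr_ge0.
by move=> [i j] _ /=; rewrite ord1; exact: coord_le_enorm.
Qed.

Lemma enorm_continuous : continuous (@enorm R d).
Proof.
move=> x; apply: (@continuous_comp _ _ _ _ (@Num.sqrt R)); last first.
  exact: sqrt_continuous.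
apply: (@continuous_big _ _ _ _ xpredT) => [|i _ y]; first exact: add_continuous.
have h := @coord_continuous R 1 d ord0 i y.
exact: (cvgM h h).
Qed.

Lemma closed_slab (T : R) : closed (@slab R d T).
Proof.
rewrite (_ : slab T = fst @^-1` `[0, T]%classic); last first.
  by apply/seteqP; split=> z /=; rewrite in_itv.
apply: preimage_closed; last exact: interval_closed.
by move=> z _; exact: cvg_fst.
Qed.

(** The product norm is a maximum, so the ball lies in a product of a segment and a closed ball of
    ['rV[R]_d], both compact. These sets are the compact neighbourhoods on which convergence over
    compacts is used. *)
Lemma compact_closed_ball_slab z0 (r T : R) :
  compact ([set z | `|z - z0| <= r] `&` slab T).
Proof.
apply: (@subclosed_compact _ _
  ([set s | `|s - z0.1| <= r] `*` [set x | `|x - z0.2| <= r])).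
- apply: closedI; last exact: closed_slab.
  rewrite (_ : mkset _ = (fun z => `|z - z0|) @^-1` [set s | s <= r])//.
  apply: preimage_closed; last exact: closed_le.
  move=> z _; apply: cvg_norm; apply: cvgB; [exact: cvg_id|exact: cvg_cst].
- apply: compact_setX.
    rewrite (_ : mkset _ = `[z0.1 - r, z0.1 + r]%classic).
      exact: segment_compact.
    by apply/seteqP; split=> s /=; rewrite in_itv/= ler_distl.
  apply: bounded_closed_compact.
    exists (`|z0.2| + r); split; first exact: num_real.
    move=> M rM x /= xr; rewrite -(subrK z0.2 x).
    by rewrite (le_trans (ler_normD _ _))// addrC (le_trans _ (ltW rM))// lerD2l.
  rewrite (_ : mkset _ = (fun x => `|x - z0.2|) @^-1` [set s | s <= r])//.
  apply: preimage_closed; last exact: closed_le.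
  move=> z _; have h : continuous (fun x => x - z0.2).
    move=> x; apply: (@continuousB _ _ _ id (cst z0.2)) => //.
    exact: cst_continuous.
  exact: (cvg_norm (h z)).
- move=> z [/= + _]; rewrite prod_normE ge_max => /andP[? ?].
  by split.
Qed.

(** The usual argument with [e / 3], carried out on a compact neighbourhood of the point in the
    slab. *)
Lemma within_slab_limit_continuous {V : normedModType R} (T : R)
    (f : nat -> R * 'rV[R]_d -> V) (g : R * 'rV[R]_d -> V) :
  (forall k, {within slab T, continuous (f k)}) ->
  cvg_on_compacts (slab T) f g -> {within slab T, continuous g}.
Proof.
move=> fc /cvg_on_compactsP fg; apply/subspace_continuousP => z0 Tz0.
apply/cvgrPdist_lt => e e0; have e30 : 0 < e / 3 by rewrite divr_gt0.
set C := [set z | `|z - z0| <= 1] `&` slab T.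
have Cz0 : C z0 by split => //=; rewrite subrr normr0.
have [k _ /(_ k (leqnn k)) fk] := fg C (@compact_closed_ball_slab _ _ _)
  (@subIsetr _ _ _) _ e30.
have /subspace_continuousP/(_ _ Tz0)/cvgrPdist_lt/(_ _ e30) := fc k.
have : \forall z \near within (slab T) (nbhs z0), C z.
  rewrite /within/=; have : nbhs z0 (ball z0 (1 : R)) by exact: nbhsx_ballx.
  apply: filterS => z; rewrite -ball_normE /ball_/= => zz Tz; split=> //=.
  by rewrite distrC ltW.
apply: filterS2 => z Cz fz.
have -> : g z0 - g z = (g z0 - f k z0) + (f k z0 - f k z) + (f k z - g z).
  by rewrite !subrKA.
have -> : e = e / 3 + e / 3 + e / 3 by field.
apply: le_lt_trans (ler_normD _ _) _.
apply: ltrD; last by rewrite distrC; exact: fk.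
by rewrite (le_lt_trans (ler_normD _ _))// ltrD//; exact: fk.
Qed.

End Space.

(** * Calculus of C^k functions *)

Section Ck.
Context {R : realType} {V : normedModType R}.
Implicit Types (W : set V) (f g : V -> R) (v w z : V) (c : R).

Lemma Ck_on_continuous k W f z : Ck_on k W f -> W z -> {for z, continuous f}.
Proof. by case: k => [|k] [fc _]; exact: fc. Qed.

Lemma Ck_on_derivable k W f v z : Ck_on k.+1 W f -> W z -> derivable f z v.
Proof. by move=> [_ /(_ v)[+ _]]; exact. Qed.

Lemma Ck_on_derive k W f v : Ck_on k.+1 W f -> Ck_on k W (fun z => 'D_v f z).
Proof. by move=> [_ /(_ v)[]]. Qed.

Lemma Ck_onS k W f : Ck_on k.+1 W f -> Ck_on k W f.
Proof.
elim: k f => [|k IH] f Wf; first by case: Wf.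
split=> [z|v]; first exact: Ck_on_continuous Wf.
split=> [z|]; first exact: Ck_on_derivable Wf.
exact/IH/Ck_on_derive.
Qed.

Lemma Ck_on_subset k W W' f : W' `<=` W -> Ck_on k W f -> Ck_on k W' f.
Proof.
move=> sub; elim: k f => [|k IH] f Wf.
  by split=> // z /sub; exact: Ck_on_continuous Wf.
split=> [z /sub|v]; first exact: Ck_on_continuous Wf.
split=> [z /sub|]; first exact: Ck_on_derivable Wf.
exact/IH/Ck_on_derive.
Qed.

Lemma open_eq_near W f g z :
  open W -> W z -> {in W, f =1 g} -> {near z, f =1 g}.
Proof.
move=> oW Wz fg; have : nbhs z W by exact: open_nbhs_nbhs.
by apply: filterS => y Wy; apply: fg; rewrite inE.
Qed.

Lemma open_eq_derive W f g v z :
  open W -> W z -> {in W, f =1 g} -> 'D_v f z = 'D_v g z.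
Proof.
by move=> oW Wz fg; apply: near_eq_derive; exact: (open_eq_near oW Wz fg).
Qed.

(** Rules of calculus identify derivatives only on [W], where the functions are derivable. As [W] is
    open, such an identity holds near each of its points and can be differentiated again. *)
Lemma Ck_on_eq k W f g :
  open W -> {in W, f =1 g} -> Ck_on k W f -> Ck_on k W g.
Proof.
move=> oW; have contg (h l : V -> R) : {in W, h =1 l} ->
    (forall z, W z -> {for z, continuous h}) ->
    forall z, W z -> {for z, continuous l}.
  move=> hl hc z Wz; have lz : l z = h z by rewrite hl// inE.
  suff lc : l y @[y --> z] --> h z by rewrite -lz in lc; exact: lc.
  by apply: cvg_trans (hc _ Wz); exact: near_eq_cvg (open_eq_near oW Wz hl).
elim: k f g => [|k IH] f g fg Wf; split => //.
- by apply: contg fg _ => z; exact: Ck_on_continuous Wf.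
- by apply: contg fg _ => z; exact: Ck_on_continuous Wf.
- move=> v; split=> [z Wz|].
    apply: near_eq_derivable (Ck_on_derivable Wf Wz).
    exact: (open_eq_near oW Wz fg).
  apply: IH (Ck_on_derive v Wf) => z; rewrite inE => Wz.
  exact: (open_eq_derive _ oW Wz fg).
Qed.

Lemma Ck_on_cst k W c : Ck_on k W (cst c).
Proof.
elim: k c => [|k IH] c; (split=> [z _|//]; first exact: cst_continuous) => v.
split=> [z _|]; first exact: derivable_cst.
rewrite (_ : (fun z => _) = cst 0); first exact: IH.
by apply/funext => z; rewrite derive_cst.
Qed.

Lemma Ck_onD k W f g : open W -> Ck_on k W f -> Ck_on k W g -> Ck_on k W (f \+ g).
Proof.
move=> oW; elim: k f g => [|k IH] f g Wf Wg.
  split=> // z Wz; apply: continuousD; [exact: Ck_on_continuous Wf Wz|].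
  exact: Ck_on_continuous Wg Wz.
split=> [z Wz|v].
  by apply: continuousD;
    [exact: Ck_on_continuous Wf Wz|exact: Ck_on_continuous Wg Wz].
split=> [z Wz|].
  by apply: derivableD;
    [exact: Ck_on_derivable Wf Wz|exact: Ck_on_derivable Wg Wz].
apply: Ck_on_eq (IH _ _ (Ck_on_derive v Wf) (Ck_on_derive v Wg)) => //.
move=> z; rewrite inE => Wz; rewrite /= deriveD//.
  exact: Ck_on_derivable Wf Wz.
exact: Ck_on_derivable Wg Wz.
Qed.

Lemma Ck_onM k W f g : open W -> Ck_on k W f -> Ck_on k W g -> Ck_on k W (f \* g).
Proof.
move=> oW; elim: k f g => [|k IH] f g Wf Wg.
  split=> // z Wz; apply: continuousM; [exact: Ck_on_continuous Wf Wz|].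
  exact: Ck_on_continuous Wg Wz.
split=> [z Wz|v].
  by apply: continuousM;
    [exact: Ck_on_continuous Wf Wz|exact: Ck_on_continuous Wg Wz].
split=> [z Wz|].
  by apply: derivableM;
    [exact: Ck_on_derivable Wf Wz|exact: Ck_on_derivable Wg Wz].
apply: (@Ck_on_eq _ _
  ((f \* (fun z => 'D_v g z)) \+ (g \* (fun z => 'D_v f z)))) => //.
  move=> z; rewrite inE => Wz; rewrite /= deriveM//.
    exact: Ck_on_derivable Wf Wz.
  exact: Ck_on_derivable Wg Wz.
(* Each Leibniz term pairs a derivative, of class [k], with an undifferentiated factor of class
   [k.+1], which is lowered to [k]. *)
apply: Ck_onD => //; apply: IH; [exact: Ck_onS|exact: Ck_on_derive|
  exact: Ck_onS|exact: Ck_on_derive].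
Qed.

Lemma Ck_onN k W f : open W -> Ck_on k W f -> Ck_on k W (\- f).
Proof.
move=> oW Wf; have : Ck_on k W (cst (-1) \* f).
  by apply: Ck_onM => //; exact: Ck_on_cst.
by apply: Ck_on_eq => // z _ /=; rewrite mulN1r.
Qed.

Lemma Ck_on_sum k W (I : Type) (r : seq I) (F : I -> V -> R) :
  open W -> (forall i, Ck_on k W (F i)) -> Ck_on k W (fun z => \sum_(i <- r) F i z).
Proof.
move=> oW WF; elim: r => [|i r IH].
  by apply: Ck_on_eq (Ck_on_cst k W 0) => // z _; rewrite big_nil.
apply: Ck_on_eq (Ck_onD oW (WF i) IH) => // z _.
by rewrite big_cons.
Qed.

(** The two difference quotients are the same function, so this holds for every [f], derivable or
    not. *)
Lemma derive_addc f c v z : 'D_v (f \+ cst c) z = 'D_v f z.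
Proof.
rewrite /derive; set F := (fun h => _); set G := (fun h => _).
suff -> : F = G by [].
apply/funext => h; rewrite /F /G /=.
by congr (_ *: _); rewrite /cst opprD addrACA subrr addr0.
Qed.

Lemma affine_derive (l : {linear V -> R}) c v z :
  continuous l -> is_derive z v (fun y => l y + c) (l v).
Proof.
move=> lc; have dl : differentiable l z by exact: linear_differentiable.
apply: DeriveDef.
  by apply: derivableD; [exact: diff_derivable|exact: derivable_cst].
have -> : (fun y => l y + c) = l \+ cst c by [].
by rewrite derive_addc deriveE// diff_lin.
Qed.

(** The first derivatives are the constants [l v], so [Ck_on_cst] settles all higher orders at
    once. *)
Lemma Ck_on_affine k W (l : {linear V -> R}) c :
  open W -> continuous l -> Ck_on k W (fun y => l y + c).
Proof.
move=> oW lc; have cont z : {for z, continuous (fun y => l y + c)}.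
  by apply: continuousD; [exact: lc|exact: cst_continuous].
case: k => [|k]; split=> // v; split=> [z _|].
  by have := affine_derive c v z lc; case.
apply: Ck_on_eq (Ck_on_cst k W (l v)) => // z _ /=.
by have := affine_derive c v z lc; case=> _ ->.
Qed.

(** Every term of a first or second derivative of [h \* h] keeps a factor [h] or a product of two
    first derivatives of [h], all zero at [z]. *)
Lemma derive_square_eq0 W h z :
  open W -> W z -> Ck_on 2 W h -> h z = 0 -> (forall v, 'D_v h z = 0) ->
  (forall v, 'D_v (h \* h) z = 0) /\
  (forall v w, 'D_w (fun y => 'D_v (h \* h) y) z = 0).
Proof.
move=> oW Wz Wh hz Dhz.
have dh v y : W y -> 'D_v (h \* h) y = h y * 'D_v h y + h y * 'D_v h y.
  by move=> Wy; rewrite deriveM; [|exact: Ck_on_derivable Wh Wy..].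
split=> [v|v w]; first by rewrite dh// hz !mul0r addr0.
rewrite (@open_eq_derive W _
  ((h \* (fun y => 'D_v h y)) \+ (h \* (fun y => 'D_v h y))))//.
  have dM : derivable (h \* (fun y => 'D_v h y)) z w.
    apply: derivableM; first exact: Ck_on_derivable Wh Wz.
    exact: Ck_on_derivable (Ck_on_derive v Wh) Wz.
  rewrite deriveD// deriveM; last 2 first.
  - exact: Ck_on_derivable Wh Wz.
  - exact: Ck_on_derivable (Ck_on_derive v Wh) Wz.
  by rewrite hz !Dhz !scale0r !addr0.
by move=> y; rewrite inE => Wy; rewrite dh.
Qed.

End Ck.

(** * Stability of viscosity solutions *)

Section Bump.
Context {R : realType} {d : nat}.
Notation Rd := 'rV[R]_d.
Implicit Types (z : R * Rd) (W : set (R * Rd)).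

(** The coordinates are named so that they can be registered as linear maps and [Ck_on_affine]
    applies to them. *)
Definition time_coord (z : R * Rd) : R := z.1.
Definition space_coord (i : 'I_d) (z : R * Rd) : R := z.2 ord0 i.

Lemma time_coord_linear : linear time_coord. Proof. by []. Qed.
Lemma space_coord_linear i : linear (space_coord i).
Proof. by move=> a x y; rewrite /space_coord !mxE. Qed.

HB.instance Definition _ :=
  GRing.isLinear.Build R (R * Rd)%type R *:%R time_coord time_coord_linear.
HB.instance Definition _ i :=
  GRing.isLinear.Build R (R * Rd)%type R *:%R (space_coord i) (space_coord_linear i).

Lemma time_coord_continuous : continuous time_coord.
Proof. by move=> z; exact: cvg_fst. Qed.

Lemma space_coord_continuous i : continuous (space_coord i).
Proof.
move=> z; apply: (@continuous_comp _ _ _ snd (fun x : Rd => x ord0 i)).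
  exact: cvg_snd.
exact: coord_continuous.
Qed.

(** The squared Euclidean distance in space-time: a polynomial, unlike the maximum norm of the
    product. Squares are written as products to match [Ck_onM]. *)
Definition sqdist z0 z : R :=
  (time_coord z - time_coord z0) * (time_coord z - time_coord z0) +
  \sum_(i < d)
    (space_coord i z - space_coord i z0) * (space_coord i z - space_coord i z0).

Lemma sqdist_Ck k W z0 : open W -> Ck_on k W (sqdist z0).
Proof.
move=> oW; apply: (@Ck_onD _ _ k W (fun z => _ * _) (fun z => \sum_(i < d) _)) => //.
  have h := Ck_on_affine k (- time_coord z0) oW time_coord_continuous.
  exact: Ck_onM.
apply: Ck_on_sum => // i.
have h := Ck_on_affine k (- space_coord i z0) oW (@space_coord_continuous i).
exact: Ck_onM.
Qed.

Lemma sqdist0 z0 : sqdist z0 z0 = 0.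
Proof. by rewrite /sqdist subrr mulr0 add0r big1// => i _; rewrite subrr mulr0. Qed.

Lemma derive_sqdist0 z0 v : 'D_v (sqdist z0) z0 = 0.
Proof.
have H (l : {linear (R * Rd)%type -> R}) : continuous l ->
    is_derive z0 v (fun z => (l z - l z0) * (l z - l z0)) 0.
  move=> lc; have := affine_derive (- l z0) v z0 lc => h.
  have := is_deriveM h h; rewrite subrr !scale0r addr0.
  by [].
have := is_deriveD (H _ time_coord_continuous)
  (is_derive_sum (fun i => H _ (@space_coord_continuous i))).
case=> _; rewrite [RHS]add0r [RHS]big1// => <-; congr ('D_v _ z0).
by apply/funext => z; rewrite /sqdist /= fct_sumE.
Qed.

(** The product norm is the larger of the time and space norms, and the square of each is bounded by
    its own part of [sqdist]. *)
Lemma sqr_norm_le_sqdist z0 z : `|z - z0| ^+ 2 <= sqdist z0 z.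
Proof.
have s0 : 0 <= \sum_(i < d)
    (space_coord i z - space_coord i z0) * (space_coord i z - space_coord i z0).
  by apply: sumr_ge0 => i _; rewrite -expr2 sqr_ge0.
rewrite prod_normE /= /sqdist.
case: (leP `|z.1 - z0.1| `|z.2 - z0.2|) => _; last first.
  by rewrite real_normK ?num_real// expr2 lerDl.
rewrite -[leLHS]add0r lerD// -?expr2 ?sqr_ge0//.
apply: (@le_trans _ _ (enorm (z.2 - z0.2) ^+ 2)).
  by rewrite lerXn2r ?nnegrE ?norm_le_enorm// sqrtr_ge0.
rewrite sqr_sqrtr; last by apply: sumr_ge0 => i _; rewrite sqr_ge0.
by apply: ler_sum => i _; rewrite !mxE expr2.
Qed.

(** [sqdist] alone would make the contact strict, but its second derivatives at [z0] do not all
    vanish and would alter the Laplacian; its square cures this. *)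
Definition bump z0 : R * Rd -> R := sqdist z0 \* sqdist z0.

Lemma bump_Ck k W z0 : open W -> Ck_on k W (bump z0).
Proof. by move=> oW; apply: Ck_onM => //; exact: sqdist_Ck. Qed.

Lemma bump0 z0 : bump z0 z0 = 0.
Proof. by rewrite /bump/= sqdist0 mulr0. Qed.

Lemma bump_ge z0 z : `|z - z0| ^+ 4 <= bump z0 z.
Proof.
rewrite (_ : 4%N = (2 + 2)%N)// exprD.
by apply: ler_pM; rewrite ?exprn_ge0// sqr_norm_le_sqdist.
Qed.

Lemma bump_derive0 z0 : (forall v, 'D_v (bump z0) z0 = 0) /\
  (forall v w, 'D_w (fun y => 'D_v (bump z0) y) z0 = 0).
Proof.
apply: (@derive_square_eq0 _ _ setT); rewrite ?sqdist0//.
- exact: openT.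
- exact/sqdist_Ck/openT.
- exact: derive_sqdist0.
Qed.

End Bump.

(** * Contact points of the approximating solutions *)

Section Touching.
Context {R : realType} {d : nat}.
Notation Rd := 'rV[R]_d.

(* Adding the bump makes the contact point strict, so that the maxima of
   [psi k - (phi + bump)] near [z0] are interior. *)
Lemma touching_points (T : R) (psi : nat -> R * Rd -> R) (psi0 : R * Rd -> R)
    (z0 : R * Rd) (W : set (R * Rd)) (phi : R * Rd -> R) (rho : R) :
  (forall k, {within slab T, continuous (psi k)}) ->
  cvg_on_compacts (slab T) psi psi0 ->
  slab T z0 -> open W -> W z0 -> Ck_on 2 W phi ->
  (forall z, W z -> slab T z -> psi0 z <= phi z) -> phi z0 = psi0 z0 ->
  0 < rho ->
  \forall k \near \oo, exists z W' c,
    [/\ `|z - z0| < rho, slab T z, open W', W' z & W' `<=` W] /\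
    (forall y, W' y -> slab T y -> psi k y <= (phi \+ bump z0 \+ cst c) y) /\
    (phi \+ bump z0 \+ cst c) z = psi k z.
Proof.
move=> psic /cvg_on_compactsP psicvg Tz0 oW Wz0 Wphi le_phi eq_phi rho0.
have : nbhs z0 W by exact: open_nbhs_nbhs.
move=> /nbhs_ballP[r1 /= r10 r1W].
(* Halving places the closed ball of radius [r] inside [W], which the compactness argument needs,
   and keeps [r] strictly below [rho]. *)
pose r := Num.min (r1 / 2) (rho / 2).
have r0 : 0 < r by rewrite lt_min !divr_gt0.
have rW z : `|z - z0| <= r -> W z.
  move=> zr; apply: r1W; rewrite -ball_normE /ball_/= distrC.
  apply: (le_lt_trans zr); rewrite (@le_lt_trans _ _ (r1 / 2))//.
    by rewrite /r ge_min lexx.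
  by rewrite ltr_pdivrMr// ltr_pMr// ltr1n.
have rrho : r < rho.
  rewrite (@le_lt_trans _ _ (rho / 2))//; first by rewrite /r ge_min lexx orbT.
  by rewrite ltr_pdivrMr// ltr_pMr// ltr1n.
set C := [set z | `|z - z0| <= r] `&` slab T.
have cC : compact C by exact: compact_closed_ball_slab.
have Cz0 : C z0 by split => //=; rewrite subrr normr0 ltW.
(* The error is made twice, at [z0] and at the maximum point; together this stays below [r ^+ 4],
   the least possible value of the bump on the sphere of radius [r]. *)
have e0 : 0 < r ^+ 4 / 2 by rewrite divr_gt0// exprn_gt0.
have := psicvg C cC (@subIsetr _ _ _) _ e0.
apply: filterS => k psik.
have [||z] := @compact_EVT_max _ _ (psi k \- (phi \+ bump z0)) C _ cC.
- by exists z0.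
- have : {within C, continuous psi k}.
    exact: continuous_subspaceW (@subIsetr _ _ _) (psic k).
  move=> pC x; apply: continuousB; first exact: pC.
  move: x; apply: continuous_in_subspaceT => x; rewrite inE => -[/rW Wx _].
  apply: continuousD; first exact: Ck_on_continuous Wphi Wx.
  exact: Ck_on_continuous (bump_Ck 0 z0 openT) I.
rewrite inE => -[/= zr Tz] zmax.
have := zmax z0; rewrite inE => /(_ Cz0)/=; rewrite bump0 addr0 => zmax0.
(* On the sphere the difference would be below [r ^+ 4 / 2 - r ^+ 4], whereas at [z0] it exceeds
   [- (r ^+ 4 / 2)], against maximality. *)
have zltr : `|z - z0| < r.
  rewrite lt_neqAle zr andbT; apply/negP => /eqP zrE.
  have h1 := psik z0 Cz0.
  have h2 := psik z (conj zr Tz).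
  have h3 := le_phi z (rW _ zr) Tz.
  have h4 := bump_ge z0 z; rewrite zrE in h4.
  move: h1 h2; rewrite !ltr_norml => /andP[h1 h1'] /andP[h2 h2'].
  lra.
(* The translation constant is the maximum of the difference; the open ball is a neighbourhood of
   [z] because [z] is interior. *)
exists z, (ball z0 r), (psi k z - (phi z + bump z0 z)).
split; [split => //|split].
- exact: lt_trans zltr _.
- exact: ball_open.
- by rewrite -ball_normE /ball_/= distrC.
- by move=> y; rewrite -ball_normE /ball_/= distrC => /ltW/rW.
- move=> y; rewrite -ball_normE /ball_/= distrC => /ltW yr Ty.
  have := zmax y; rewrite inE => /(_ (conj yr Ty))/=.
  rewrite /cst; lra.
- by rewrite /cst/=; lra.
Qed.

End Touching.

(** * Limits of viscosity solutions *)

Section Stability.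
Context {R : realType} {d : nat}.
Notation Rd := 'rV[R]_d.
Implicit Types (z : R * Rd) (W : set (R * Rd)).

Lemma dxE i (phi : R * Rd -> R) :
  dx i phi = (fun z => 'D_((0, delta_mx ord0 i) : R * Rd) phi z).
Proof. by []. Qed.

Lemma grad_addc (phi : R * Rd -> R) c z : grad (phi \+ cst c) z = grad phi z.
Proof. by apply/rowP => i; rewrite !mxE /dx derive_addc. Qed.

Lemma laplacian_addc (phi : R * Rd -> R) c z :
  laplacian (phi \+ cst c) z = laplacian phi z.
Proof.
apply: eq_bigr => i _; congr (dx i _ z).
by apply/funext => y; rewrite /dx derive_addc.
Qed.

Lemma dt_addc (phi : R * Rd -> R) c z : dt (phi \+ cst c) z = dt phi z.
Proof. exact: derive_addc. Qed.

Lemma derive_add_bump W (phi : R * Rd -> R) z0 v : Ck_on 2 W phi -> W z0 ->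
  'D_v (phi \+ bump z0) z0 = 'D_v phi z0.
Proof.
move=> Wphi Wz0; rewrite deriveD.
- by rewrite (bump_derive0 z0).1 addr0.
- exact: Ck_on_derivable Wphi Wz0.
- exact: Ck_on_derivable (bump_Ck 1 z0 openT) I.
Qed.

Lemma laplacian_add_bump W (phi : R * Rd -> R) z0 :
  open W -> Ck_on 2 W phi -> W z0 ->
  laplacian (phi \+ bump z0) z0 = laplacian phi z0.
Proof.
move=> oW Wphi Wz0; apply: eq_bigr => i _; rewrite dxE.
rewrite (@open_eq_derive _ _ W _ (dx i phi \+ dx i (bump z0)))//.
  rewrite deriveD; last 2 first.
  - exact: Ck_on_derivable (Ck_on_derive _ Wphi) Wz0.
  - exact: Ck_on_derivable (Ck_on_derive _ (bump_Ck 2 z0 openT)) I.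
  by rewrite (bump_derive0 z0).2 addr0.
move=> z; rewrite inE => Wz; rewrite /dx deriveD//.
- exact: Ck_on_derivable Wphi Wz.
- exact: Ck_on_derivable (bump_Ck 1 z0 openT) I.
Qed.

Lemma visc_subsolution_limit (T : R) (b : nat -> R -> Rd -> Rd) (b0 : R -> Rd -> Rd)
    (D : nat -> R) (D0 : R) (psi : nat -> R * Rd -> R) (psi0 : R * Rd -> R) :
  (forall k, {within slab T, continuous (psi k)}) ->
  (forall k, visc_subsolution T (b k) (D k) (psi k)) ->
  {within slab T, continuous (fun z : R * Rd => b0 z.1 z.2)} ->
  cvg_on_compacts (slab T) (fun k (z : R * Rd) => b k z.1 z.2)
    (fun z => b0 z.1 z.2) ->
  D k @[k --> \oo] --> D0 ->
  cvg_on_compacts (slab T) psi psi0 ->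
  visc_subsolution T b0 D0 psi0.
Proof.
move=> psic sub b0c /cvg_on_compactsP bcvg Dcvg psicvg z0 W phi.
move=> /andP[z0gt0 z0T] oW Wz0 Wphi le_phi eq_phi.
have Tz0 : slab T z0 by rewrite /slab/= ltW.
pose F := phi \+ bump z0.
have WF : Ck_on 2 W F := (Ck_onD oW Wphi (bump_Ck 2 z0 oW)).
(* For each precision, one index and one contact point. The indices need not tend to infinity, since
   the closeness of the point, the field and the diffusion is recorded explicitly. *)
have approx (m : nat) : exists p : nat * (R * Rd),
    [/\ `|p.2 - z0| < m.+1%:R^-1, slab T p.2, W p.2,
        `|b0 p.2.1 p.2.2 - b p.1 p.2.1 p.2.2| < m.+1%:R^-1 &
        `|D0 - D p.1| < m.+1%:R^-1] /\
    dt F p.2 <= dotp (b p.1 p.2.1 p.2.2) (grad F p.2) + D p.1 * laplacian F p.2.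
  have m0 : 0 < m.+1%:R^-1 :> R by rewrite invr_gt0.
  (* The bound by [z0.1] keeps the contact point at positive time, where the sub-solution inequality
     is available. *)
  pose rho := Num.min m.+1%:R^-1 z0.1.
  have rho0 : 0 < rho by rewrite lt_min m0.
  have touch := touching_points psic psicvg Tz0 oW Wz0 Wphi le_phi eq_phi rho0.
  have bm := bcvg _ (@compact_closed_ball_slab _ _ z0 m.+1%:R^-1 T)
    (@subIsetr _ _ _) _ m0.
  have /cvgrPdist_lt/(_ _ m0) Dm := Dcvg.
  have : \forall k \near \oo, exists z,
    [/\ `|z - z0| < m.+1%:R^-1, slab T z, W z,
        `|b0 z.1 z.2 - b k z.1 z.2| < m.+1%:R^-1 &
        `|D0 - D k| < m.+1%:R^-1] /\
    dt F z <= dotp (b k z.1 z.2) (grad F z) + D k * laplacian F z.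
    apply: filterS3 touch bm Dm => k [z [W' [c [[zz0 Tz oW' W'z W'W]]]]].
    move=> [le_psi eq_psi] bk Dk.
    have zm : `|z - z0| < m.+1%:R^-1.
      by rewrite (lt_le_trans zz0)// /rho ge_min lexx.
    exists z; split; first split => //.
    - exact: W'W.
    - by apply: bk; split => //=; exact: ltW.
    (* The constant [c] changes no derivative, so the inequality for the translate is one for
       [F]. *)
    - have W'F : Ck_on 2 W' (F \+ cst c) :=
        Ck_onD oW' (Ck_on_subset W'W WF) (Ck_on_cst 2 W' c).
      have zgt0 : 0 < z.1.
        have : `|z - z0| < z0.1 by rewrite (lt_le_trans zz0)// /rho ge_min lexx orbT.
        rewrite prod_normE gt_max => /andP[/= + _].
        by rewrite ltr_norml => /andP[+ _]; rewrite ltrBrDr addNr.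
      have zT : 0 < z.1 <= T by rewrite zgt0; case/andP: Tz.
      have := sub k z W' (F \+ cst c) zT oW' W'z W'F le_psi eq_psi.
      by rewrite dt_addc grad_addc laplacian_addc.
  by move=> /filter_ex[k [z kz]]; exists (k, z).
have {approx}[p ap] := choice approx.
have inv_lt (e : R) : 0 < e -> \forall m \near \oo, m.+1%:R^-1 < e.
  move=> e0; have /cvgrPdist_lt/(_ _ e0) := @cvg_harmonic R.
  by apply: filterS => m; rewrite sub0r normrN ger0_norm ?invr_ge0.
have pz0 : (p m).2 @[m --> \oo] --> z0.
  apply/cvgrPdist_lt => e e0; have := inv_lt _ e0.
  apply: filterS => m me; rewrite distrC.
  by have [[zm _ _ _ _] _] := ap m; exact: lt_trans zm me.
have b0p : b0 (p m).2.1 (p m).2.2 @[m --> \oo] --> b0 z0.1 z0.2.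
  have /subspace_continuousP/(_ _ Tz0) h := b0c.
  apply: (cvg_comp _ _ _ h) => A nA.
  have pA : \forall m \near \oo, slab T (p m).2 -> A (p m).2 := pz0 _ nA.
  suff : \forall m \near \oo, A (p m).2 by [].
  by apply: filterS pA => m; apply; have [[]] := ap m.
(* Both the field and the point vary: the recorded error controls [b] against [b0] at the moving
   point, and continuity of [b0] within the slab does the rest. *)
have bp : b (p m).1 (p m).2.1 (p m).2.2 @[m --> \oo] --> b0 z0.1 z0.2.
  apply/cvgrPdist_lt => e e0; have e20 : 0 < e / 2 by rewrite divr_gt0.
  have := inv_lt _ e20; have /cvgrPdist_lt/(_ _ e20) := b0p.
  apply: filterS2 => m b0m me.
  rewrite -(subrKA (b0 (p m).2.1 (p m).2.2)) (le_lt_trans (ler_normD _ _))//.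
  rewrite [ltRHS]splitr ltrD//.
  by have [[_ _ _ bm _] _] := ap m; exact: lt_trans bm me.
have Dp : D (p m).1 @[m --> \oo] --> D0.
  apply/cvgrPdist_lt => e e0; have := inv_lt _ e0.
  apply: filterS => m me.
  by have [[_ _ _ _ Dm] _] := ap m; exact: lt_trans Dm me.
have dp v : 'D_v F (p m).2 @[m --> \oo] --> 'D_v F z0.
  have := Ck_on_continuous (Ck_on_derive v WF) Wz0.
  exact: (cvg_comp _ _ pz0).
have ddp v w : 'D_w (fun y => 'D_v F y) (p m).2 @[m --> \oo] -->
    'D_w (fun y => 'D_v F y) z0.
  have := Ck_on_continuous (Ck_on_derive w (Ck_on_derive v WF)) Wz0.
  exact: (cvg_comp _ _ pz0).
have lim_le : dt F z0 <= dotp (b0 z0.1 z0.2) (grad F z0) + D0 * laplacian F z0.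
  apply: (@ler_cvg_to nat \oo _ R (fun m => dt F (p m).2)
    (fun m => dotp (b (p m).1 (p m).2.1 (p m).2.2) (grad F (p m).2) +
              D (p m).1 * laplacian F (p m).2)).
  - exact: dp.
  - apply: cvgD; last first.
      apply: cvgM => //; apply: cvg_big => [|i _]; first exact: add_continuous.
      exact: ddp.
    apply: cvg_big => [|i _]; first exact: add_continuous.
    apply: cvgM; last by under eq_fun do rewrite mxE; rewrite mxE; exact: dp.
    exact: (cvg_comp _ _ bp (@coord_continuous R 1 d ord0 i _)).
  - by near=> m; have [_] := ap m.
have -> : dt phi z0 = dt F z0 by rewrite /dt (derive_add_bump _ Wphi).
have -> : grad phi z0 = grad F z0.
  by apply/rowP => i; rewrite !mxE /dx (derive_add_bump _ Wphi).
by rewrite -(laplacian_add_bump oW Wphi Wz0).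
Unshelve. all: by end_near. Qed.

(** Both sides of the equation are odd in the function, and [phi] touches [psi] from below exactly
    when [\- phi] touches [\- psi] from above. *)
Lemma visc_supersolutionN (T : R) (b : R -> Rd -> Rd) (D : R) (psi : R * Rd -> R) :
  visc_supersolution T b D psi <-> visc_subsolution T b D (\- psi).
Proof.
have derivN W (phi : R * Rd -> R) v z : Ck_on 2 W phi -> W z ->
    'D_v (\- phi) z = - 'D_v phi z.
  by move=> Wphi Wz; rewrite deriveN//; exact: Ck_on_derivable Wphi Wz.
have gradN W (phi : R * Rd -> R) z : Ck_on 2 W phi -> W z ->
    grad (\- phi) z = - grad phi z.
  by move=> Wphi Wz; apply/rowP => i; rewrite !mxE /dx (derivN W).
have lapN W (phi : R * Rd -> R) z : open W -> Ck_on 2 W phi -> W z ->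
    laplacian (\- phi) z = - laplacian phi z.
  move=> oW Wphi Wz; rewrite -sumrN; apply: eq_bigr => i _; rewrite dxE.
  rewrite (@open_eq_derive _ _ W _ (\- dx i phi))//.
    by rewrite deriveN//; exact: Ck_on_derivable (Ck_on_derive _ Wphi) Wz.
  by move=> y; rewrite inE => Wy; rewrite /dx (derivN W).
have dotpN (x y : Rd) : dotp x (- y) = - dotp x y.
  by rewrite -sumrN; apply: eq_bigr => i _; rewrite mxE mulrN.
split=> sol z0 W phi z0T oW Wz0 Wphi le_phi eq_phi.
- have := sol z0 W (\- phi) z0T oW Wz0 (Ck_onN oW Wphi).
  rewrite (gradN W)// (lapN W)// /dt (derivN W)// dotpN mulrN -opprD lerN2; apply.
    by move=> z Wz Tz; rewrite /= lerNl; exact: le_phi.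
  by rewrite /= eq_phi opprK.
- have := sol z0 W (\- phi) z0T oW Wz0 (Ck_onN oW Wphi).
  rewrite (gradN W)// (lapN W)// /dt (derivN W)// dotpN mulrN -opprD lerN2; apply.
    by move=> z Wz Tz; rewrite /= lerN2; exact: le_phi.
  by rewrite /= eq_phi.
Qed.

(** Used twice: along the approximating systems for a fixed test function, then along test functions
    with field and diffusion fixed. *)
Lemma visc_solution_limit (T : R) (b : nat -> R -> Rd -> Rd) (b0 : R -> Rd -> Rd)
    (D : nat -> R) (D0 : R) (psi : nat -> R * Rd -> R) (psi0 : R * Rd -> R) :
  (forall k, visc_solution T (b k) (D k) (psi k)) ->
  cvg_on_compacts (slab T) (fun k (z : R * Rd) => b k z.1 z.2)
    (fun z => b0 z.1 z.2) ->
  D k @[k --> \oo] --> D0 ->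
  cvg_on_compacts (slab T) psi psi0 ->
  visc_solution T b0 D0 psi0.
Proof.
move=> sol bcvg Dcvg psicvg.
have bc : {within slab T, continuous (fun z : R * Rd => b0 z.1 z.2)}.
  by apply: within_slab_limit_continuous bcvg => k; case: (sol k).
have psic k : {within slab T, continuous (psi k)} by case: (sol k).
split=> //; first exact: within_slab_limit_continuous psicvg.
- by apply: (visc_subsolution_limit psic _ bc bcvg Dcvg psicvg) => k; case: (sol k).
- apply/visc_supersolutionN.
  apply: (@visc_subsolution_limit _ b _ D _ (fun k => \- psi k)) => //.
  + by move=> k z; apply: continuousN; exact: psic.
  + by move=> k; apply/visc_supersolutionN; case: (sol k).
  + apply/cvg_on_compactsP => C cC CT e e0.
    move/cvg_on_compactsP: psicvg => /(_ C cC CT e e0).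
    by apply: filterS => k psik z Cz; rewrite -opprD normrN; exact: psik.
Qed.

End Stability.

(** * Test functions and integrals *)

Section TestFunctions.
Context {R : realType} {d : nat}.
Notation Rd := 'rV[R]_d.
Implicit Types (f : Rd -> R) (x y v : Rd).

Lemma derivable_line f v :
  (forall x, derivable f x v) -> forall x (t : R),
  is_derive t (1 : R) (fun s : R => f (s *: v + x)) ('D_v f (t *: v + x)).
Proof.
move=> df x t.
have E : (fun h : R => h^-1 *: (f ((h *: 1 + t) *: v + x) - f (t *: v + x))) =
    (fun h : R => h^-1 *: (f (h *: v + (t *: v + x)) - f (t *: v + x))).
  apply/funext => h; congr (_ *: (f _ - _)).
  by rewrite scalerDl addrA -[h%:A]/(h * 1) mulr1.
apply: DeriveDef.
  have := df (t *: v + x); rewrite /derivable/= => H.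
  by rewrite /derivable /= E.
by rewrite /derive /= E.
Qed.

(** Mean value theorem along the line, with the end points exchanged for negative [t]. *)
Lemma line_lipschitz f v M :
  (forall x, derivable f x v) -> (forall x, `|'D_v f x| <= M) ->
  forall x (t : R), `|f (t *: v + x) - f x| <= M * `|t|.
Proof.
move=> df Mf x t; pose F (s : R) := f (s *: v + x).
have dF (s : R) : is_derive s (1 : R) F ('D_v f (s *: v + x)).
  exact: derivable_line.
have cF (a b : R) : {within `[a, b], continuous F}.
  apply: continuous_subspaceT => s; apply: differentiable_continuous.
  by apply/derivable1_diffP; have [] := dF s.
have H a b : a <= b -> `|F b - F a| <= M * (b - a).
  move=> ab; have [c _ ->] := MVT_segment ab (fun s _ => dF s) (@cF a b).
  by rewrite normrM (ger0_norm (_ : 0 <= b - a)) ?subr_ge0// ler_wpM2r// subr_ge0.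
have -> : f x = F 0 by rewrite /F scale0r add0r.
rewrite -/(F t); have [t0|t0] := leP 0 t.
  by rewrite (ger0_norm t0); have := H _ _ t0; rewrite subr0.
by rewrite distrC (ltr0_norm t0) -[in leRHS](add0r (- t)); exact/H/ltW.
Qed.

(** The derivative is continuous, hence bounded on a compact ball; outside it [f] vanishes near the
    point. The ball of the library norm suffices, this norm being at most [enorm]. *)
Lemma compact_support_derive_bounded f v :
  test_function f -> exists M, forall x, `|'D_v f x| <= M.
Proof.
move=> [fC [r fr]].
have cD : continuous (fun x => 'D_v f x).
  by move=> x; exact: Ck_on_continuous (Ck_on_derive v (fC 1)) I.
have cB : compact [set x : Rd | `|x| <= r].
  apply: bounded_closed_compact.
    exists r; split; first exact: num_real.
    by move=> M rM x /= xr; exact: le_trans xr (ltW rM).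
  rewrite (_ : mkset _ = (fun x => `|x|) @^-1` [set s | s <= r])//.
  apply: preimage_closed; last exact: closed_le.
  by move=> x _; exact: norm_continuous.
have cI := continuous_compact (continuous_subspaceT cD) cB.
(* Boundedness is given for every number strictly above [M], hence [M + 1]; the [0] covers the
   points outside the ball. *)
have [M [_ HM]] := compact_bounded cI; exists (Num.max (M + 1) 0) => x.
have [xr|xr] := leP `|x| r.
  by rewrite le_max HM ?ltrDl//; exists x.
rewrite (_ : 'D_v f x = 0) ?normr0 ?le_max ?lexx ?orbT//.
rewrite -(derive_cst (0 : R) x v); apply: near_eq_derive.
have : \forall y \near x, r < `|y|.
  by have := @norm_continuous _ _ x; move/cvgr_gt; exact.
by apply: filterS => y ry; rewrite fr//; exact: lt_le_trans ry (norm_le_enorm y).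
Qed.

(* The two points are joined by changing one coordinate at a time. *)
Lemma test_function_bounded_gradient f : test_function f -> bounded_gradient f.
Proof.
move=> tf; have [fC _] := tf.
have [M HM] := choice (fun i : 'I_d =>
  compact_support_derive_bounded (delta_mx ord0 i) tf).
have M0 i : 0 <= M i by exact: le_trans (HM i 0).
(* Each of the [d] coordinate changes is charged the sum of all the bounds, so that every step has
   the same cost. *)
exists (d%:R * \sum_i M i) => x y.
pose w k : Rd := \row_j (if (j < k)%N then y ord0 j else x ord0 j).
have step k : (k <= d)%N -> `|f x - f (w k)| <= k%:R * (\sum_i M i * enorm (x - y)).
  elim: k => [|k IH] kd.
    rewrite mul0r (_ : w 0%N = x) ?subrr ?normr0//.
    by apply/rowP => j; rewrite mxE.
  rewrite -natr1 mulrDl mul1r -(subrKA (f (w k))).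
  rewrite (le_trans (ler_normD _ _))// lerD ?IH ?(ltnW kd)//.
  pose i := Ordinal kd.
  have -> : w k.+1 = (y ord0 i - x ord0 i) *: delta_mx ord0 i + w k.
    apply/rowP => j; rewrite !mxE eqxx/= ltnS leq_eqVlt.
    have [ji|ji] := eqVneq j i.
      by rewrite ji eqxx ltnn/= mulr1 subrK.
    rewrite (_ : (j == k :> nat) = false) ?mulr0 ?add0r//.
    by apply/negbTE; apply: contraNneq ji => jk; apply/eqP/val_inj.
  rewrite distrC (le_trans (line_lipschitz _ (HM i) _ _))//.
    by move=> z; exact: Ck_on_derivable (fC 1) I.
  rewrite -mulr_suml ler_pM//.
    by rewrite (bigD1 i)//= lerDl sumr_ge0.
  by rewrite distrC; have := coord_le_enorm (x - y) i; rewrite !mxE.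
have := step d (leqnn d); rewrite (_ : w d = y); last first.
  by apply/rowP => j; rewrite mxE ltn_ord.
by rewrite -mulr_suml mulrA.
Qed.

Lemma test_function_vanishing_continuous f :
  test_function f -> vanishing_continuous f.
Proof.
move=> [fC [r fr]]; split=> [x|e e0]; first exact: Ck_on_continuous (fC 0) I.
by exists r => x /fr ->; rewrite normr0 ltW.
Qed.

End TestFunctions.

(** * Integrals of functions of linear growth *)

Section Integrals.
Context {R : realType} {d : nat}.
Notation Rd := 'rV[R]_d.
Implicit Types (mu : probability (borelRd R d) R).

(** Open intervals generate the Borel sets of [R], and their preimages are open, that is, generators
    of [borelRd]. *)
Lemma continuous_borel_measurable (f : Rd -> R) :
  continuous f -> measurable_fun [set: borelRd R d] (f : borelRd R d -> R).
Proof.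
move=> /continuousP cf; apply: (measurability _ (RGenOpens.measurableE R)).
move=> _ [_ [a [b ->] <-]]; rewrite setTI; apply: sub_sigma_algebra.
exact/cf/interval_open.
Qed.

Lemma linear_growth_integrable mu (C : R) : in_P1 mu ->
  mu.-integrable setT (fun x : borelRd R d => (C * (1 + enorm (x : Rd)))%:E).
Proof.
move=> mu1; have menorm := continuous_borel_measurable (@enorm_continuous R d).
have ie : mu.-integrable setT (fun x : borelRd R d => (enorm (x : Rd))%:E).
  apply/integrableP; split; first exact/measurable_EFinP.
  under eq_integral => x _ do rewrite gee0_abs ?lee_fin ?sqrtr_ge0//.
  exact: mu1.
rewrite (_ : (fun x => _) = (fun x : borelRd R d =>
  C%:E * (1%:E + (enorm (x : Rd))%:E)))%E; last first.
  by apply/funext => x; rewrite EFinM.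
apply: integrableZl => //; apply: (@integrableD _ _ _ _ _ _ (cst 1%:E)) => //.
exact: finite_measure_integrable_cst.
Qed.

(** Dominated convergence: the finite first moment makes [C * (1 + enorm x)] integrable. *)
Lemma Rintegral_cvg_linear_growth mu (f : nat -> Rd -> R) (g : Rd -> R) (C : R) :
  in_P1 mu -> (forall m, continuous (f m)) ->
  (forall x, f m x @[m --> \oo] --> g x) ->
  (forall m x, `|f m x| <= C * (1 + enorm x)) ->
  \int[mu]_x f m x @[m --> \oo] --> \int[mu]_x g x.
Proof.
move=> mu1 fc fg fC.
have iC := linear_growth_integrable C mu1.
have mf m : measurable_fun setT (EFin \o (f m : borelRd R d -> R)).
  by apply/measurable_EFinP; exact: (continuous_borel_measurable (fc m)).
have fgE (x : borelRd R d) : setT x -> (f m x)%:E @[m --> \oo] --> (g x)%:E.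
  by move=> _; apply: cvg_EFin; [exact: nearW|exact: fg].
have fCE m (x : borelRd R d) : setT x ->
    (`|(f m x)%:E| <= (C * (1 + enorm (x : Rd)))%:E)%E.
  by move=> _; rewrite lee_fin; exact: fC.
have fin (x : borelRd R d) : setT x ->
  (C * (1 + enorm (x : Rd)))%:E \is a fin_num by [].
have := dominated_cvg measurableT mf fgE fin iC fCE.
(* The limit obeys the same bound, so its integral is finite; this turns convergence in the extended
   reals into convergence of real integrals. *)
have ig : mu.-integrable setT (fun x : borelRd R d => (g x)%:E).
  apply: (le_integrable measurableT _ _ iC).
    exact: (emeasurable_fun_cvg _ _ mf fgE).
  move=> x _; rewrite lee_fin; apply: le_trans (ler_norm _).
  apply: (@ler_cvg_to nat \oo _ R (fun m => `|f m x|)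
    (fun=> C * (1 + enorm (x : Rd)))).
  - exact: cvg_norm.
  - exact: cvg_cst.
  - exact: nearW.
rewrite -(fineK (integrable_fin_num measurableT ig)) => h.
exact: fine_cvg h.
Qed.

End Integrals.

(** * Passage to the limit *)

Section TimeReversal.
Context {R : realType} {d : nat}.
Notation Rd := 'rV[R]_d.

Lemma time_reversal_continuous (T : R) :
  continuous (fun z : R * Rd => (T - z.1, z.2)).
Proof.
move=> z; have c1 : {for z, continuous (fun y : R * Rd => T - y.1)}.
  by apply: (@continuousB _ _ _ (cst T) fst); [exact: cst_continuous|exact: cvg_fst].
have c2 : {for z, continuous (fun y : R * Rd => y.2)} by exact: cvg_snd.
exact: (cvg_pair c1 c2).
Qed.

(** A whole time slice lies in the slab, so continuity within the slab becomes unrestricted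
    continuity in space. This provides measurability of the solutions at the final time. *)
Lemma slab_slice_continuous {V : topologicalType} (T : R) (f : R * Rd -> V) (s : R) :
  0 <= s <= T -> {within slab T, continuous f} -> continuous (fun x => f (s, x)).
Proof.
move=> sT /subspace_continuousP fc x.
apply: (cvg_comp _ _ _ (fc (s, x) sT)) => A nA.
have c1 : {for x, continuous (fun=> s : R)} by exact: cst_continuous.
have c2 : {for x, continuous (fun y : Rd => y)} by [].
have pc : (s, y) @[y --> x] --> (s, x) by exact: (cvg_pair c1 c2).
have sA : \forall y \near x, slab T (s, y) -> A (s, y) := pc _ nA.
suff : \forall y \near x, A (s, y) by [].
by apply: filterS sA => y; exact.
Qed.

End TimeReversal.

Theorem theorem2p14 (R : realType) (n d : nat) (n_ge1 : (1 <= n)%N) (d_ge1 : (1 <= d)%N)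
    (D : nat -> 'I_n -> R) (K : nat -> operator R n d)
    (mu : nat -> curve R n d) (Psi : nat -> solution_maps R n d)
    (Dinf : 'I_n -> R) (Kinf : operator R n d)
    (muinf : curve R n d) (Psiinf : solution_maps R n d)
    (D_ge0 : forall k i, 0 <= D k i)
    (K_adm : forall k, admissible_operator (K k))
    (mu_C : forall k (t : R), 0 < t -> curve_C t (mu k))
    (pairs : forall k, entropy_pair (D k) (K k) (mu k) (Psi k))
    (muinf_P1 : forall (t : R) i, 0 <= t -> in_P1 (muinf t i))
    (Psiinf_lin : forall T : R, 0 <= T -> linear_solution_map T (Psiinf T))
    (Psiinf_det : forall T : R, 0 <= T -> determined_by_test_functions T (Psiinf T))
    (D_cvg : forall i, D k i @[k --> \oo] --> Dinf i)
    (mu_cvg : forall (t : R) i, 0 < t ->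
       weak_star_cvg (fun k => mu k t i) (muinf t i))
    (Psi_cvg : forall (psi0 : 'rV[R]_d -> R) (T : R) (i : 'I_n),
       test_function psi0 -> 0 <= T ->
       cvg_on_compacts (slab T) (fun k => Psi k T psi0 i) (Psiinf T psi0 i))
    (K_cvg : forall (T : R) (i : 'I_n), 0 < T ->
       cvg_on_compacts (slab T)
         (fun k (z : R * 'rV[R]_d) => at_time (K k) (mu k) z.1 i z.2)
         (fun z : R * 'rV[R]_d => at_time Kinf muinf z.1 i z.2))
    (int_cvg : forall (psi0 : 'rV[R]_d -> R) (T : R) (i : 'I_n),
       test_function psi0 -> 0 < T ->
       \int[mu k 0 i]_x Psi k T psi0 i (T, x) @[k --> \oo]
         --> \int[muinf 0 i]_x Psiinf T psi0 i (T, x)) :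
  entropy_pair Dinf Kinf muinf Psiinf.
Proof.
have field_cvg (T : R) i : 0 <= T -> cvg_on_compacts (slab T)
    (fun k (z : R * 'rV[R]_d) => - at_time (K k) (mu k) (T - z.1) i z.2)
    (fun z => - at_time Kinf muinf (T - z.1) i z.2).
  move=> T0.
  (* [K_cvg] concerns positive horizons, while [T] may be [0]; the horizon [T + 1] covers both
     cases. *)
  have revT : (fun z : R * 'rV[R]_d => (T - z.1, z.2)) @` slab T `<=`
      slab (T + 1).
    move=> _ [z /andP[z0 zT] <-]; rewrite /slab/= subr_ge0 zT/=.
    by rewrite lerBlDr (@le_trans _ _ (T + 1))// ?lerDl// lerDr.
  have T1 : 0 < T + 1 by rewrite ltr_wpDl.
  have /cvg_on_compactsP h := cvg_on_compacts_comp
    (@time_reversal_continuous R d T) revT (K_cvg (T + 1) i T1).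
  apply/cvg_on_compactsP => C cC CS e e0.
  apply: filterS (h C cC CS e e0) => k hk z Cz.
  by rewrite -opprD normrN; exact: hk.
have test_grad f : test_function f -> bounded_gradient f :=
  @test_function_bounded_gradient R d f.
(* The viscosity inequalities concern positive times only, so the initial value is passed to the
   limit pointwise: first in [k] for test functions, then along test functions. *)
have initial psi0 T i x : 0 <= T -> bounded_gradient psi0 ->
    Psiinf T psi0 i (0, x) = psi0 x.
  move=> T0 grad0; have T00 : slab T ((0, x) : R * 'rV[R]_d) by rewrite /slab/= lexx.
  have init_test f : test_function f -> Psiinf T f i (0, x) = f x.
    move=> tf; have h := cvg_on_compacts_pointwise (Psi_cvg f T i tf T0) T00.
    suff h' : Psi k T f i (0, x) @[k --> \oo] --> f x.
      exact: norm_cvg_unique h h'.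
    rewrite (_ : (fun k => _) = (fun=> f x)); first exact: cvg_cst.
    apply/funext => k; have [_ sol _] := pairs k T T0.
    by have [_ ->] := sol f (test_grad f tf) i.
  have [phi [tphi phi_cvg _ Psi_phi_cvg _]] := Psiinf_det T T0 psi0 grad0.
  have h := cvg_on_compacts_pointwise (Psi_phi_cvg i) T00.
  suff h' : Psiinf T (phi m) i (0, x) @[m --> \oo] --> psi0 x.
    exact: norm_cvg_unique h h'.
  rewrite (_ : (fun m => _) = (fun m => phi m x)).
    exact: (cvg_on_compacts_pointwise phi_cvg I).
  by apply/funext => m; exact: init_test.
move=> T T0; have [_ Psi_reg] := Psiinf_lin T T0.
split; first exact: Psiinf_lin.
- move=> psi0 grad0 i; split; last by move=> x; exact: initial.
  have sol_test f : test_function f -> visc_solution T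
      (fun s x => - at_time Kinf muinf (T - s) i x) (Dinf i) (Psiinf T f i).
    pose b k s x := - at_time (K k) (mu k) (T - s) i x.
    move=> tf; apply: (@visc_solution_limit _ _ _ b _ (D^~ i) _
      (fun k => Psi k T f i)).
    - move=> k; have [_ sol _] := pairs k T T0.
      by have [] := sol f (test_grad f tf) i.
    - exact: field_cvg.
    - exact: D_cvg.
    - exact: Psi_cvg.
  have [phi [tphi _ _ Psi_phi_cvg _]] := Psiinf_det T T0 psi0 grad0.
  (* Second use of stability, now with constant sequences of fields and diffusions. *)
  apply: (@visc_solution_limit _ _ _
    (fun=> fun s x => - at_time Kinf muinf (T - s) i x) _ (fun=> Dinf i) _
    (fun m => Psiinf T (phi m) i)).
  + by move=> m; exact: sol_test.
  + apply/cvg_on_compactsP => C cC CS e e0; apply: nearW => m z Cz.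
    by rewrite subrr normr0.
  + exact: cvg_cst.
  + exact: Psi_phi_cvg.
- move=> i; split; first exact: muinf_P1.
  (* [mu_cvg] and [int_cvg] are available at positive times; at [T = 0] the duality identity is the
     initial condition. *)
  move=> psi0 grad0; have [T00|Tneq0] := eqVneq T 0.
    by subst T; congr Rintegral; apply/funext => x; rewrite initial.
  have Tgt0 : 0 < T by rewrite lt_neqAle eq_sym Tneq0.
  have TT (x : 'rV[R]_d) : slab T (T, x) by rewrite /slab/= T0 lexx.
  have dual_test f : test_function f ->
      \int[muinf T i]_x f x = \int[muinf 0 i]_x Psiinf T f i (T, x).
    move=> tf; have h := int_cvg f T i tf Tgt0.
    (* By duality for each [k], one sequence has both integrals as limits. *)
    suff h' : \int[mu k 0 i]_x Psi k T f i (T, x) @[k --> \oo] -->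
        \int[muinf T i]_x f x.
      exact: norm_cvg_unique h' h.
    rewrite (_ : (fun k => _) = (fun k => \int[mu k T i]_x f x)).
      exact/mu_cvg/test_function_vanishing_continuous.
    apply/funext => k; have [_ _ dual] := pairs k T T0.
    by have [_ ->] := dual i; last exact: test_grad.
  have [phi [tphi phi_cvg [C phiC] Psi_phi_cvg Psi_bound]] :=
    Psiinf_det T T0 psi0 grad0.
  have [C' PsiC] := Psi_bound i.
  (* The two sides are taken to the limit against different measures, at times [T] and [0], and with
     separate growth constants [C] and [C']. *)
  have lhs : \int[muinf T i]_x phi m x @[m --> \oo] --> \int[muinf T i]_x psi0 x.
    apply: (Rintegral_cvg_linear_growth (C := C)) => //; first exact: muinf_P1.
      by move=> m; have [] := test_function_vanishing_continuous (tphi m).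
    by move=> x; exact: (cvg_on_compacts_pointwise phi_cvg I).
  have rhs : \int[muinf 0 i]_x Psiinf T (phi m) i (T, x) @[m --> \oo] -->
      \int[muinf 0 i]_x Psiinf T psi0 i (T, x).
    apply: (Rintegral_cvg_linear_growth (C := C')) => //; first exact: muinf_P1.
    + move=> m; apply: (@slab_slice_continuous _ _ _ T); first by rewrite T0 lexx.
      by have [] := Psi_reg _ (test_grad _ (tphi m)) i.
    + by move=> x; exact: (cvg_on_compacts_pointwise (Psi_phi_cvg i)).
    + by move=> m x; exact: PsiC.
  have dualE : (fun m => \int[muinf T i]_x phi m x) =
      (fun m => \int[muinf 0 i]_x Psiinf T (phi m) i (T, x)).
    by apply/funext => m; exact: dual_test.
  by rewrite dualE in lhs; exact: norm_cvg_unique lhs rhs.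
Qed.
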